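(* Assume periodic boundary conditions, summation-by-parts Fourier spectral operators $\nabla_h,\nabla_h\cdot,\nabla_h\times,\Delta_h$ on a uniform periodic three-dimensional mesh, constants $\kappa,\sigma_1,\sigma_2,\Delta t>0$ with $\sigma_1=\kappa^2\sigma_2$, and finitely many particles $i$ with masses $m_i>0$ and charges $q_i\in\mathbb R$. Let particle data $(\boldsymbol x_i^n,\boldsymbol v_i^n,\boldsymbol P_i^n)$ and mesh data $(\phi^n,\psi^n,\boldsymbol A^n,\boldsymbol U^n,\rho^n)$, $n=0,1,2,\dots$, satisfy exactly (fully converged coupled nonlinear solve, orbit integrals evaluated exactly) for every $n\ge0$: (i) the Crank--Nicolson field update $$\frac{\phi^{n+1}-\phi^n}{\Delta t}=\psi^{n+1/2},\qquad \frac{\psi^{n+1}-\psi^n}{\Delta t}=\kappa^2\Delta_h\phi^{n+1/2}+\kappa^2\sigma_1\rho^{n+1/2},$$ $$\frac{\boldsymbol A^{n+1}-\boldsymbol A^n}{\Delta t}=\boldsymbol U^{n+1/2},\qquad \frac{\boldsymbol U^{n+1}-\boldsymbol U^n}{\Delta t}=\kappa^2\Delta_h\boldsymbol A^{n+1/2}+\kappa^2\sigma_2\boldsymbol J^{n+1/2};$$ (ii) the continuity update $\dfrac{\rho^{n+1}-\rho^n}{\Delta t}+\nabla_h\cdot\boldsymbol J^{n+1/2}=0$; (iii) the orbit current $\boldsymbol J_g^{n+1/2}=\dfrac1{\Delta V}\sum_i q_i\,\overline{\boldsymbol v}_i\,\overline S_{ig}$; (iv) the orbit-discrete-gradient particle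 push $$\overline{\boldsymbol v}_i=\tfrac12(\boldsymbol v_i^{n+1}+\boldsymbol v_i^n),\qquad \boldsymbol x_i^{n+1}=\boldsymbol x_i^n+\Delta t\,\overline{\boldsymbol v}_i,$$ $$\boldsymbol P_i^{n+1}=\boldsymbol P_i^n+\Delta t\left[-q_i\,\overline{\nabla\phi}_i+q_i(\mathsf D_i\boldsymbol A)^T\overline{\boldsymbol v}_i\right],\qquad m_i\boldsymbol v_i^{n+1}=\boldsymbol P_i^{n+1}-q_i\boldsymbol A_h^{n+1}(\boldsymbol x_i^{n+1}),$$ with initially $m_i\boldsymbol v_i^0=\boldsymbol P_i^0-q_i\boldsymbol A_h^0(\boldsymbol x_i^0)$. Assume also that the initial data satisfy the Lorenz gauge and Gauss's law, $\frac1{\kappa^2}\psi^0+\nabla_h\cdot\boldsymbol A^0=0$ and $\nabla_h\cdot\boldsymbol E^0=\sigma_1\rho^0$ (for every resolved Fourier mode). Then the total discrete energy $$\mathcal E^n=\sum_i\tfrac12 m_i|\boldsymbol v_i^n|^2+\sum_g\left(\frac1{2\sigma_1}|\boldsymbol E_g^n|^2+\frac1{2\sigma_2}|\boldsymbol B_g^n|^2\right)\Delta V$$ satisfies $\mathcal E^{n+1}=\mathcal E^n$ for every $n\ge0$.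
   Context: Mesh quantities are real periodic functions on the uniform mesh with index $g$ and cell volume $\Delta V$, all stored at the same points: $\phi,\psi,\rho$ scalar, $\boldsymbol A,\boldsymbol U,\boldsymbol J,\boldsymbol E,\boldsymbol B$ three-component vectors. For quantities stored at integer levels, $f^{n+1/2}=\tfrac12(f^{n+1}+f^n)$. The fields are $\boldsymbol E_g^n=-\nabla_h\phi_g^n-\boldsymbol U_g^n$ and $\boldsymbol B_g^n=\nabla_h\times\boldsymbol A_g^n$. Spatial operators: Fourier spectral operators act on each resolved Fourier mode with real wave vector $\boldsymbol k$ by $\nabla_h\mapsto\mathrm i\boldsymbol k$, $\nabla_h\cdot\mapsto\mathrm i\boldsymbol k\cdot$, $\nabla_h\times\mapsto\mathrm i\boldsymbol k\times$, $\Delta_h\mapsto-|\boldsymbol k|^2$, with the same $\boldsymbol k$ in all operators. They map real mesh functions to real mesh functions and satisfy summation by parts: $\sum_g\nabla_hf_g\cdot\boldsymbol G_g\,\Delta V=-\sum_g f_g\,\nabla_h\cdot\boldsymbol G_g\,\Delta V$ and $\sum_g(\nabla_h\times\boldsymbol F)_g\cdot\boldsymbol G_g\,\Delta V=\sum_g\boldsymbol F_g\cdot(\nabla_h\times\boldsymbol G)_g\,\Delta V$. Particle shapes: $S_g:\mathbb R^3\to\mathbb R$ is the periodic particle shape attached to mesh point $g$. It is either continuously differentiable, or a tensor product of one-dimensional continuous periodic piecewise polynomials with finitely many knots per period (e.g. B-splines of degree at least $1$). In the latter case, derivatives at knots where they do not exist are assigned one of their one-sided values by a fixed convention. The mesh-interpolated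 vector potential is $\boldsymbol A_h^n(\boldsymbol x)=\sum_g\boldsymbol A_g^nS_g(\boldsymbol x)$. Orbit quantities for the step $n\to n+1$ (positions unwrapped): $\boldsymbol x_i(s)=\boldsymbol x_i^n+s(\boldsymbol x_i^{n+1}-\boldsymbol x_i^n)$ and $\boldsymbol A_g(s)=(1-s)\boldsymbol A_g^n+s\boldsymbol A_g^{n+1}$ for $0\le s\le1$. The orbit-averaged shape is $\overline S_{ig}=\int_0^1S_g(\boldsymbol x_i(s))\,\mathrm ds$, and the orbit-averaged potential gradient is $\overline{\nabla\phi}_i=\sum_g(\nabla_h\phi_g^{n+1/2})\,\overline S_{ig}$. The orbit-discrete-gradient matrix is $[\mathsf D_i\boldsymbol A]_{\ell j}=\sum_g\int_0^1A_{\ell,g}(s)\,\partial_{x_j}S_g(\boldsymbol x_i(s))\,\mathrm ds$ for $1\le\ell,j\le3$, where $A_{\ell,g}(s)$ is the $\ell$-th component of $\boldsymbol A_g(s)$. *)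

(* Defs.v *)
From mathcomp Require Import all_boot all_order all_algebra.
From mathcomp Require Import all_classical all_reals all_analysis.
From mathcomp Require Export complex.

Set Implicit Arguments.
Unset Strict Implicit.
Unset Printing Implicit Defensive.

Import Order.TTheory GRing.Theory Num.Theory.
Import numFieldNormedType.Exports.

Local Open Scope classical_set_scope.
Local Open Scope ring_scope.
Local Open Scope complex_scope.

(* Euclidean products.  The library norm on 'rV[R]_3 is the sup norm, so |u|^2
   is written dot u u. *)
Definition dot (K : comNzRingType) (u v : 'rV[K]_3) : K :=
  \sum_(j < 3) u 0 j * v 0 j.

Definition cross (K : comNzRingType) (u v : 'rV[K]_3) : 'rV[K]_3 :=
  \row_j (u 0 (j + 1) * v 0 (j + 2) - u 0 (j + 2) * v 0 (j + 1)).

Section Mesh.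
Variables (R : realType) (N : 'I_3 -> nat) (L : 'rV[R]_3).

(* One period of the mesh, with N d points and period L 0 d along axis d.  A
   periodic mesh function is a function on this type. *)
Definition mesh : finType := ('I_(N 0) * 'I_(N 1) * 'I_(N 2))%type.

Definition cell_volume : R := \prod_(d < 3) (L 0 d / (N d)%:R).

(* Fourier modes are indexed by the mesh; mode p is
   g |-> exp (i * mode_phase p g). *)
Definition mode_phase (p g : mesh) : R :=
  2 * pi * ((p.1.1 * g.1.1)%:R / (N 0)%:R + (p.1.2 * g.1.2)%:R / (N 1)%:R
            + (p.2 * g.2)%:R / (N 2)%:R).

Definition dft (f : mesh -> R) (p : mesh) : R[i] :=
  \sum_(g : mesh) (f g)%:C * (cos (mode_phase p g) -i* sin (mode_phase p g)).

Definition vdft (F : mesh -> 'rV[R]_3) (p : mesh) : 'rV[R[i]]_3 :=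
  \row_j dft (fun g => F g 0 j) p.

Definition ivec (k : 'rV[R]_3) : 'rV[R[i]]_3 := map_mx (fun a => 0 +i* a) k.

(* Real operators given by their symbols on every mode of the mesh.  The wave
   vector k p is not forced to be 2 pi p / L for a choice of representatives:
   this leaves the treatment of the Nyquist modes free.  That the operators
   send real functions to real functions forces k to be odd in p modulo N.
   Summation by parts is not a field: it follows from Parseval, k being real. *)
Record spectral_ops := SpectralOps {
  wavevec : mesh -> 'rV[R]_3;
  grad : (mesh -> R) -> mesh -> 'rV[R]_3;
  div : (mesh -> 'rV[R]_3) -> mesh -> R;
  curl : (mesh -> 'rV[R]_3) -> mesh -> 'rV[R]_3;
  lap : (mesh -> R) -> mesh -> R;
  grad_symbol : forall f p,
    vdft (grad f) p = dft f p *: ivec (wavevec p);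
  div_symbol : forall F p,
    dft (div F) p = dot (ivec (wavevec p)) (vdft F p);
  curl_symbol : forall F p,
    vdft (curl F) p = cross (ivec (wavevec p)) (vdft F p);
  lap_symbol : forall f p,
    dft (lap f) p = - (dot (wavevec p) (wavevec p))%:C * dft f p }.

Definition vlap (ops : spectral_ops) (F : mesh -> 'rV[R]_3) (g : mesh)
  : 'rV[R]_3 := \row_j lap ops (fun g' => F g' 0 j) g.

Definition electric (ops : spectral_ops) (phi : mesh -> R)
  (U : mesh -> 'rV[R]_3) (g : mesh) : 'rV[R]_3 := - grad ops phi g - U g.

Definition magnetic (ops : spectral_ops) (A : mesh -> 'rV[R]_3)
  : mesh -> 'rV[R]_3 := curl ops A.

End Mesh.

(* f^{n+1/2} for a mesh quantity stored at integer levels. *)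
Definition mid (R : realType) (V : lmodType R) (T : Type) (f : nat -> T -> V)
  (n : nat) (g : T) : V := 2^-1 *: (f n.+1 g + f n g).

Section Shape.
Variables (R : realType) (L : 'rV[R]_3).

Definition axis (j : 'I_3) : 'rV[R]_3 := delta_mx 0 j.

(* Continuous, periodic, polynomial between consecutive knots
   t 0 < ... < t m = t 0 + l spanning one period. *)
Definition periodic_piecewise_poly (l : R) (w : R -> R) : Prop :=
  [/\ continuous w, forall x, w (x + l) = w x &
      exists (m : nat) (t : nat -> R),
        [/\ t m = t 0%N + l, forall i, (i < m)%N -> t i < t i.+1 &
            forall i, (i < m)%N -> exists p : {poly R},
              forall x, t i <= x <= t i.+1 -> w x = p.[x]]].

(* dw x is the left or the right derivative of w at x; where w is derivable both
   are the derivative, so this constrains dw up to the convention at knots. *)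
Definition one_sided_derivative (w dw : R -> R) : Prop :=
  forall x, (h^-1 * (w (x + h) - w x) @[h --> 0^'-] --> dw x) \/
            (h^-1 * (w (x + h) - w x) @[h --> 0^'+] --> dw x).

Definition C1_shape (S : 'rV[R]_3 -> R) (dS : 'I_3 -> 'rV[R]_3 -> R) : Prop :=
  [/\ forall x, differentiable S x,
      forall j, continuous (fun x => 'D_(axis j) S x) &
      forall j x, dS j x = 'D_(axis j) S x].

Definition tensor_shape (S : 'rV[R]_3 -> R) (dS : 'I_3 -> 'rV[R]_3 -> R)
  : Prop :=
  exists w dw : 'I_3 -> R -> R,
    [/\ forall d, periodic_piecewise_poly (L 0 d) (w d),
        forall d, one_sided_derivative (w d) (dw d),
        forall x, S x = \prod_(d < 3) w d (x 0 d) &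
        forall j x, dS j x = dw j (x 0 j) * \prod_(d < 3 | d != j) w d (x 0 d)].

(* dS j is the partial derivative of S along axis j,
   including the convention at the knots. *)
Definition particle_shape (S : 'rV[R]_3 -> R) (dS : 'I_3 -> 'rV[R]_3 -> R)
  : Prop :=
  (forall d x, S (x + L 0 d *: axis d) = S x) /\
  (C1_shape S dS \/ tensor_shape S dS).

End Shape.

Section Orbit.
Variables (R : realType) (T : finType).
Variables (S : T -> 'rV[R]_3 -> R) (dS : T -> 'I_3 -> 'rV[R]_3 -> R).

Definition interp (F : T -> 'rV[R]_3) (x : 'rV[R]_3) : 'rV[R]_3 :=
  \sum_(g : T) S g x *: F g.

(* Below, x0 and x1 are the positions of one particle at levels n and n+1. *)
Definition orbit_position (x0 x1 : 'rV[R]_3) (s : R) : 'rV[R]_3 :=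
  x0 + s *: (x1 - x0).

Definition orbit_shape (x0 x1 : 'rV[R]_3) (g : T) : R :=
  \int[lebesgue_measure]_(s in `[0, 1]) S g (orbit_position x0 x1 s).

Definition orbit_average (F : T -> 'rV[R]_3) (x0 x1 : 'rV[R]_3) : 'rV[R]_3 :=
  \sum_(g : T) orbit_shape x0 x1 g *: F g.

Definition orbit_discrete_gradient (A0 A1 : T -> 'rV[R]_3)
  (x0 x1 : 'rV[R]_3) : 'M[R]_3 :=
  \matrix_(l, j) \sum_(g : T) \int[lebesgue_measure]_(s in `[0, 1])
    (((1 - s) * A0 g 0 l + s * A1 g 0 l) * dS g j (orbit_position x0 x1 s)).

End Orbit.

Definition energy (R : realType) (N : 'I_3 -> nat) (L : 'rV[R]_3)
  (ops : spectral_ops R N) (I : finType) (m : I -> R) (sigma1 sigma2 : R)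
  (v : I -> 'rV[R]_3) (phi : mesh N -> R) (A U : mesh N -> 'rV[R]_3) : R :=
  \sum_(i : I) 2^-1 * m i * dot (v i) (v i)
  + \sum_(g : mesh N)
      ((2 * sigma1)^-1 * dot (electric ops phi U g) (electric ops phi U g)
       + (2 * sigma2)^-1 * dot (magnetic ops A g) (magnetic ops A g))
      * cell_volume N L.

(* Main.v *)
Require Import Defs.
From mathcomp Require Import all_boot all_order all_algebra.
From mathcomp Require Import all_classical all_reals all_analysis.
From mathcomp Require Import measurable_realfun.
From mathcomp Require Import ring lra zify.
Set Implicit Arguments.
Unset Strict Implicit.
Unset Printing Implicit Defensive.
Import Order.TTheory GRing.Theory Num.Theory.
Import numFieldNormedType.Exports.
Local Open Scope ring_scope.
Local Open Scope complex_scope.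

(* Simplification would otherwise unfold pi to its definition by choice and
   conjugation to a pair of real parts. *)
Local Arguments pi : simpl never.
Local Arguments conjc : simpl never.

(** The energy exchanged between particles and fields is accounted for exactly,
    because every quantity that enters the two budgets is the same orbit
    average.

    Particles: twice the dot product of the mean velocity and the velocity
    increment is the increment of |v|^2, so the kinetic energy changes by the
    mean velocity dotted with the increment of P - q A_h(x).  Along the straight orbit,
    s |-> A_g(s) S_g(x(s)) is continuous and piecewise C1, and integrating its
    derivative over [0, 1] writes the increment of A_h(x) as the orbit average
    of A^{n+1} - A^n plus the action of the discrete gradient matrix on the
    displacement (orbit_interp_diff).  The latter is, after contraction with
    the mean velocity, exactly the magnetic force term of the push, and cancels.
    What is left, summed over the particles, is - dt times the mesh integral of
    J . (grad phi + U) at the half level (kinetic_energy_step).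

    For a tensor product of splines the orbit crosses knots finitely often when
    the coordinate moves; when it does not move, the partial derivative has a
    constant factor whose value at a knot is irrelevant, being multiplied by a
    zero displacement (piecewise_poly_line).

    Fields: the Lorenz and Gauss residuals satisfy a homogeneous Crank-Nicolson
    system, so they remain zero (gauge_preserved).  The Lorenz gauge turns the
    update of U into Ampere's law for E and B, while Faraday's law follows from
    curl grad = 0.  The discrete Poynting theorem then holds by summation by
    parts for the curl (field_energy_step), and its source term is the opposite
    of the work done on the particles.

    The identities between operators follow from the same identities between
    symbols, since a mesh function is determined by its Fourier coefficients;
    this and summation by parts come from Parseval's identity. *)

(** * Characters of the mesh and Parseval's identity *)

Section expi.
Context {R : realType}.
Implicit Types x y : R.

(** The point exp (i x) of the unit circle. *)
Definition expi x : R[i] := cos x +i* sin x.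

Lemma expi0 : expi 0 = 1.
Proof. by rewrite /expi cos0 sin0. Qed.

Lemma expiD x y : expi (x + y) = expi x * expi y.
Proof. by rewrite /expi cosD sinD; simpc; congr (_ +i* _); rewrite addrC. Qed.

Lemma expi_mulrn x n : expi (x *+ n) = expi x ^+ n.
Proof. by elim: n => [|n IH]; rewrite ?expi0// mulrS exprS expiD IH. Qed.

Lemma expi2pi : expi (pi *+ 2) = 1.
Proof. by rewrite /expi cos2pi sin2pi. Qed.

Lemma expi_neq1 x : 0 < x < pi *+ 2 -> expi x != 1.
Proof.
move=> /andP[x0 x2].
apply/negP => /eqP [] c s.
have [xp|px] := ltP x pi.
  by have := @sin_gt0_pi _ x; rewrite x0 xp s ltxx => /(_ isT).
have [e|ne] := eqVneq x pi.
  by move: c; rewrite e cospi; lra.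
have : 0 < sin (x - pi).
  by apply: sin_gt0_pi; rewrite subr_gt0 lt_neqAle eq_sym ne px/= ltrBlDr -mulr2n.
by rewrite -[sin _]opprK -sinDpi subrK s oppr0 ltxx.
Qed.

Lemma expiN x : expi (- x) = conjc (expi x).
Proof. by rewrite /expi cosN sinN; simpc. Qed.

Lemma conjcM (u v : R[i]) : conjc (u * v) = conjc u * conjc v.
Proof. exact: rmorphM. Qed.

Lemma conjc_sum (T : finType) (F : T -> R[i]) :
  conjc (\sum_t F t) = \sum_t conjc (F t).
Proof. exact: rmorph_sum. Qed.

(** Orthogonality of the characters of Z / n: w ^+ n = 1 and w != 1 make the
    geometric sum of the powers of w vanish. *)
Lemma expi_orthogonal (n : nat) (a b : 'I_n) :
  \sum_(p < n) expi (2 * pi * ((p * a)%:R / n%:R)) *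
               conjc (expi (2 * pi * ((p * b)%:R / n%:R))) = (a == b)%:R * n%:R.
Proof.
have n0 : (n%:R : R) != 0.
  by rewrite pnatr_eq0 -lt0n; apply: leq_ltn_trans (ltn_ord a).
pose w := expi (2 * pi * ((a%:R - b%:R) / n%:R)).
have -> : \sum_(p < n) expi (2 * pi * ((p * a)%:R / n%:R)) *
               conjc (expi (2 * pi * ((p * b)%:R / n%:R))) = \sum_(p < n) w ^+ p.
  apply: eq_bigr => p _; rewrite -expiN -expiD -expi_mulrn; congr expi.
  by rewrite !natrM -mulr_natl; ring.
have [ab|ab] := eqVneq a b.
  rewrite /w ab subrr mul0r mulr0 expi0.
  under eq_bigr do rewrite expr1n.
  by rewrite sumr_const card_ord mul1r.
have wn : w ^+ n = 1.
  rewrite -expi_mulrn -[_ *+ n]mulr_natl.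
  have -> : n%:R * (2 * pi * ((a%:R - b%:R) / n%:R)) =
    pi *+ 2 *+ a - pi *+ 2 *+ b :> R.
    by rewrite -[pi *+ 2 *+ a]mulr_natl -[pi *+ 2 *+ b]mulr_natl; field.
  by rewrite expiD expiN !(expi_mulrn (pi *+ 2)) expi2pi !expr1n rmorph1 mulr1.
have w1 : w != 1.
  have pos (c d : 'I_n) : (d < c)%N ->
      0 < (2 * pi * ((c%:R - d%:R) / n%:R) : R) < pi *+ 2.
    move=> dc; have np : 0 < n%:R :> R by rewrite lt0r n0 ler0n.
    have cd : (d%:R < c%:R :> R) by rewrite ltr_nat.
    have cn : (c%:R < n%:R :> R) by rewrite ltr_nat.
    have d0 : (0 <= d%:R :> R) by rewrite ler0n.
    have p0 : 0 < 2 * pi :> R by rewrite mulr_gt0 ?pi_gt0.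
    apply/andP; split; first by rewrite mulr_gt0// divr_gt0// subr_gt0.
    rewrite -[ltRHS]mulr_natl gtr_pMr// ltr_pdivrMr//; lra.
  rewrite /w; have [ba|ab'|/val_inj e] := ltngtP b a.
  - exact/expi_neq1/pos.
  - have -> : 2 * pi * ((a%:R - b%:R) / n%:R) =
      - (2 * pi * ((b%:R - a%:R) / n%:R)) :> R by ring.
    rewrite expiN; apply/negP => /eqP/(congr1 (@conjc R)).
    by rewrite conjcK rmorph1; apply/eqP/expi_neq1/pos.
  - by rewrite e eqxx in ab.
rewrite mul0r; apply: (mulfI (_ : w - 1 != 0)); first by rewrite subr_eq0.
by rewrite mulr0 -subrX1 wn subrr.
Qed.

End expi.

Section DFT.
Context {R : realType} (N : 'I_3 -> nat).
Implicit Types (f h : mesh N -> R) (p g : mesh N).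

Lemma dftE f p : dft f p = \sum_g (f g)%:C * conjc (expi (mode_phase R p g)).
Proof. by apply: eq_bigr => g _. Qed.

Lemma mode_orthogonal g g' :
  \sum_(p : mesh N) expi (mode_phase R p g) * conjc (expi (mode_phase R p g')) =
  (g == g')%:R * #|mesh N|%:R.
Proof.
case: g g' => [[a b] c] [[a' b'] c'].
rewrite !card_prod !card_ord !xpair_eqE.
pose F (n : nat) (a b : 'I_n) (p : 'I_n) :=
  @expi R (2 * pi * ((p * a)%:R / n%:R)) *
               conjc (expi (2 * pi * ((p * b)%:R / n%:R))).
transitivity (\sum_(p : mesh N) F _ a a' p.1.1 * F _ b b' p.1.2 * F _ c c' p.2).
  apply: eq_bigr => p _; rewrite /F /mode_phase !(mulrDr (2 * pi)) !expiD !conjcM.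
  by ring.
rewrite -(pair_bigA _ (fun x y => F _ a a' x.1 * F _ b b' x.2 * F _ c c' y))/=.
under eq_bigr do rewrite -mulr_sumr.
rewrite -mulr_suml -(pair_bigA _ (fun x y => F _ a a' x * F _ b b' y))/=.
under eq_bigr do rewrite -mulr_sumr.
rewrite -mulr_suml !expi_orthogonal !natrM -!mulnb !natrM; ring.
Qed.

Lemma parseval f h :
  \sum_p conjc (dft f p) * dft h p = (#|mesh N|%:R * \sum_g f g * h g)%:C.
Proof.
transitivity (\sum_p \sum_g \sum_g' ((f g)%:C * (h g')%:C) *
   (expi (mode_phase R p g) * conjc (expi (mode_phase R p g')))).
  apply: eq_bigr => p _; rewrite !dftE conjc_sum mulr_suml.
  apply: eq_bigr => g _; rewrite mulr_sumr; apply: eq_bigr => g' _.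
  by rewrite conjcM conjcK conjc_real; ring.
rewrite exchange_big rmorphM/= rmorph_sum/= mulr_sumr; apply: eq_bigr => g _.
rewrite exchange_big/= (bigD1 g)//= -mulr_sumr mode_orthogonal eqxx mul1r.
rewrite big1 => [|g' /negbTE gg]; last first.
  by rewrite -mulr_sumr mode_orthogonal eq_sym gg mul0r mulr0.
by rewrite rmorphM/= rmorph_nat addr0 mulrC.
Qed.

Lemma dftD f h p : dft (fun g => f g + h g) p = dft f p + dft h p.
Proof.
by rewrite !dftE -big_split/=; apply: eq_bigr => g _; rewrite rmorphD mulrDl.
Qed.

Lemma dftZ a f p : dft (fun g => a * f g) p = a%:C * dft f p.
Proof.
by rewrite !dftE mulr_sumr/=; apply: eq_bigr => g _; rewrite rmorphM mulrA.
Qed.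

Lemma dft0 p : dft (fun=> 0) p = 0 :> R[i].
Proof. by rewrite dftE big1// => g _; rewrite mul0r. Qed.

Lemma dftN f p : dft (fun g => - f g) p = - dft f p.
Proof.
by rewrite !dftE -sumrN; apply: eq_bigr => g _; rewrite rmorphN mulNr.
Qed.

(** A mesh function all of whose Fourier coefficients vanish is zero: by
    Parseval its sum of squares is. *)
Lemma dft_eq0 f : (forall p, dft f p = 0) -> forall g, f g = 0.
Proof.
move=> f0 g; have := parseval f f; rewrite big1 => [|p _]; last by rewrite f0 mulr0.
move=> /esym/(congr1 (@complex.Re R))/=/eqP.
rewrite mulf_eq0 pnatr_eq0 cardE; case: (enum (mesh N)) (mem_enum (mesh N) g) => //= _ _ _.
rewrite psumr_eq0 => [/allP/(_ g (mem_index_enum _))/=|x _]; last first.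
  by rewrite -expr2 sqr_ge0.
by rewrite mulf_eq0 orbb => /eqP.
Qed.

Lemma dft_inj f h : (forall p, dft f p = dft h p) -> f =1 h.
Proof.
move=> fh g; apply/eqP; rewrite -subr_eq0; apply/eqP.
apply: (dft_eq0 (f := fun g => f g - h g)) => p.
by rewrite (dftD f (fun g => - h g)) dftN fh subrr.
Qed.

Lemma vdft_inj (F G : mesh N -> 'rV[R]_3) :
  (forall p, vdft F p = vdft G p) -> F =1 G.
Proof.
move=> FG g; apply/rowP => j; apply: (@dft_inj (fun g => F g 0 j) (fun g => G g 0 j)).
by move=> p; have /rowP/(_ j) := FG p; rewrite !mxE.
Qed.

End DFT.

(** * Euclidean products in dimension three *)

Section VectorAlgebra.
Context {K : comNzRingType}.
Implicit Types (u v k : 'rV[K]_3) (j : 'I_3) (a : K).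

Lemma ord3_addE j :
  [/\ j + 1 + 1 = j + 2, j + 1 + 2 = j, j + 2 + 1 = j & j + 2 + 2 = j + 1].
Proof. by case: j => -[|[|[|//]]] ?; split; apply/val_inj. Qed.

(** The coordinates may be listed cyclically from any axis, which lets the
    vector identities below be checked on one generic component. *)
Lemma dot_cyclic j u v :
  dot u v = u 0 j * v 0 j + u 0 (j + 1) * v 0 (j + 1) + u 0 (j + 2) * v 0 (j + 2).
Proof.
rewrite /dot (bigD1 j)//= (bigD1 (j + 1))/=; last first.
  by case: j => -[|[|[|//]]].
rewrite (bigD1 (j + 2))/=; last by case: j => -[|[|[|//]]].
rewrite big1 ?addr0 ?addrA// => i.
by case: j => -[|[|[|//]]] ?; case: i => -[|[|[|//]]].
Qed.

Lemma dotC u v : dot u v = dot v u.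
Proof. by apply: eq_bigr => j _; rewrite mulrC. Qed.

Lemma dotDl u1 u2 v : dot (u1 + u2) v = dot u1 v + dot u2 v.
Proof. by rewrite -big_split; apply: eq_bigr => j _; rewrite mxE mulrDl. Qed.

Lemma dotDr u v1 v2 : dot u (v1 + v2) = dot u v1 + dot u v2.
Proof. by rewrite dotC dotDl !(dotC u). Qed.

Lemma dotZl a u v : dot (a *: u) v = a * dot u v.
Proof. by rewrite mulr_sumr; apply: eq_bigr => j _; rewrite mxE mulrA. Qed.

Lemma dotZr a u v : dot u (a *: v) = a * dot u v.
Proof. by rewrite dotC dotZl dotC. Qed.

Lemma dotNl u v : dot (- u) v = - dot u v.
Proof. by rewrite -scaleN1r dotZl mulN1r. Qed.

Lemma dotNr u v : dot u (- v) = - dot u v.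
Proof. by rewrite dotC dotNl dotC. Qed.

Lemma dotBr u v1 v2 : dot u (v1 - v2) = dot u v1 - dot u v2.
Proof. by rewrite dotDr dotNr. Qed.

Lemma dot_sumr (T : finType) u (F : T -> 'rV[K]_3) :
  dot u (\sum_t F t) = \sum_t dot u (F t).
Proof.
rewrite exchange_big; apply: eq_bigr => j _.
by rewrite summxE mulr_sumr.
Qed.

Lemma crossDr k u v : cross k (u + v) = cross k u + cross k v.
Proof. by apply/rowP => j; rewrite !mxE; ring. Qed.

Lemma crossZr a k u : cross k (a *: u) = a *: cross k u.
Proof. by apply/rowP => j; rewrite !mxE; ring. Qed.

Lemma cross_self k : cross k k = 0.
Proof. by apply/rowP => j; rewrite !mxE mulrC subrr. Qed.

Lemma cross_cross k u : cross k (cross k u) = dot k u *: k - dot k k *: u.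
Proof.
apply/rowP => j; rewrite !mxE !(dot_cyclic j); case: (ord3_addE j) => -> -> -> ->.
by ring.
Qed.

Lemma dot_crossl k u v : dot (cross k u) v = - dot u (cross k v).
Proof.
rewrite !(dot_cyclic 0) !mxE.
by case: (ord3_addE 0) => -> -> -> ->; ring.
Qed.

End VectorAlgebra.

(** * Identities between spectral operators *)

Section SpectralCalculus.
Context {R : realType} (N : 'I_3 -> nat) (ops : spectral_ops R N).
Implicit Types (f h : mesh N -> R) (F G : mesh N -> 'rV[R]_3) (a : R).

Lemma vdftD F G p : vdft (fun g => F g + G g) p = vdft F p + vdft G p.
Proof.
apply/rowP => j; rewrite !mxE -dftD; congr dft.
by apply/funext => g; rewrite mxE.
Qed.

Lemma vdftZ a F p : vdft (fun g => a *: F g) p = a%:C *: vdft F p.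
Proof.
apply/rowP => j; rewrite !mxE -dftZ; congr dft.
by apply/funext => g; rewrite mxE.
Qed.

Lemma gradD f h g : grad ops (fun g => f g + h g) g = grad ops f g + grad ops h g.
Proof.
apply: (@vdft_inj R N (grad ops (fun g => f g + h g))
  (fun g => grad ops f g + grad ops h g)) => p.
by rewrite vdftD !grad_symbol dftD scalerDl.
Qed.

Lemma gradZ a f g : grad ops (fun g => a * f g) g = a *: grad ops f g.
Proof.
apply: (@vdft_inj R N (grad ops (fun g => a * f g)) (fun g => a *: grad ops f g)) => p.
by rewrite vdftZ !grad_symbol dftZ scalerA.
Qed.

Lemma divD F G g : div ops (fun g => F g + G g) g = div ops F g + div ops G g.
Proof.
apply: (@dft_inj R N (div ops (fun g => F g + G g))
  (fun g => div ops F g + div ops G g)) => p.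
by rewrite dftD !div_symbol vdftD dotDr.
Qed.

Lemma divZ a F g : div ops (fun g => a *: F g) g = a * div ops F g.
Proof.
apply: (@dft_inj R N (div ops (fun g => a *: F g)) (fun g => a * div ops F g)) => p.
by rewrite dftZ !div_symbol vdftZ dotZr.
Qed.

Lemma curlD F G g : curl ops (fun g => F g + G g) g = curl ops F g + curl ops G g.
Proof.
apply: (@vdft_inj R N (curl ops (fun g => F g + G g))
  (fun g => curl ops F g + curl ops G g)) => p.
by rewrite vdftD !curl_symbol vdftD crossDr.
Qed.

Lemma curlZ a F g : curl ops (fun g => a *: F g) g = a *: curl ops F g.
Proof.
apply: (@vdft_inj R N (curl ops (fun g => a *: F g)) (fun g => a *: curl ops F g)) => p.
by rewrite vdftZ !curl_symbol vdftZ crossZr.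
Qed.

Lemma lapD f h g : lap ops (fun g => f g + h g) g = lap ops f g + lap ops h g.
Proof.
apply: (@dft_inj R N (lap ops (fun g => f g + h g))
  (fun g => lap ops f g + lap ops h g)) => p.
by rewrite dftD !lap_symbol dftD mulrDr.
Qed.

Lemma lapZ a f g : lap ops (fun g => a * f g) g = a * lap ops f g.
Proof.
apply: (@dft_inj R N (lap ops (fun g => a * f g)) (fun g => a * lap ops f g)) => p.
by rewrite dftZ !lap_symbol dftZ mulrCA.
Qed.

Lemma vdft_vlap F p :
  vdft (vlap ops F) p = - (dot (wavevec ops p) (wavevec ops p))%:C *: vdft F p.
Proof.
apply/rowP => j; rewrite !mxE -lap_symbol; congr dft.
by apply/funext => g; rewrite mxE.
Qed.

Lemma dot_ivec (k : 'rV[R]_3) : dot (ivec k) (ivec k) = - (dot k k)%:C.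
Proof.
rewrite /dot rmorph_sum -sumrN; apply: eq_bigr => j _; rewrite !mxE.
by apply/eqP; rewrite eq_complex/= !(mul0r, mulr0, subr0, addr0, sub0r, oppr0) !eqxx.
Qed.

Lemma div_grad f g : div ops (grad ops f) g = lap ops f g.
Proof.
apply: (dft_inj (f := div ops (grad ops f))) => p.
by rewrite div_symbol grad_symbol lap_symbol dotZr dot_ivec mulrC.
Qed.

Lemma div_vlap F g : div ops (vlap ops F) g = lap ops (div ops F) g.
Proof.
apply: (dft_inj (f := div ops (vlap ops F))) => p.
by rewrite lap_symbol !div_symbol vdft_vlap dotZr.
Qed.

Lemma curl_grad f g : curl ops (grad ops f) g = 0.
Proof.
apply: (vdft_inj (F := curl ops (grad ops f)) (G := fun=> 0)) => p.
rewrite curl_symbol grad_symbol crossZr cross_self scaler0.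
apply/rowP => j; rewrite !mxE; apply/esym; rewrite -[RHS](dft0 p).
by congr dft; apply/funext => x; rewrite mxE.
Qed.

Lemma curl_curl F g :
  curl ops (curl ops F) g = grad ops (div ops F) g - vlap ops F g.
Proof.
apply: (vdft_inj (F := curl ops (curl ops F))
  (G := fun g => grad ops (div ops F) g - vlap ops F g)) => p.
have -> : (fun g => grad ops (div ops F) g - vlap ops F g) =
    (fun g => grad ops (div ops F) g + (-1) *: vlap ops F g).
  by apply/funext => x; rewrite scaleN1r.
rewrite !curl_symbol cross_cross vdftD vdftZ vdft_vlap grad_symbol div_symbol.
by rewrite dot_ivec scalerA -scaleNr (rmorphN1 (real_complex R)) mulN1r.
Qed.

Lemma vparseval F G :
  \sum_p dot (map_mx conjc (vdft F p)) (vdft G p) =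
  (#|mesh N|%:R * \sum_g dot (F g) (G g))%:C.
Proof.
rewrite exchange_big [X in _ * X]exchange_big/= mulr_sumr rmorph_sum/=.
apply: eq_bigr => j _; rewrite -parseval; apply: eq_bigr => p _.
by rewrite !mxE.
Qed.

(** Summation by parts for the curl: by Parseval, because k is real, so that
    conjugation turns ik into -ik. *)
Lemma sum_dot_curl F G :
  \sum_g dot (curl ops F g) (G g) = \sum_g dot (F g) (curl ops G g).
Proof.
have [g0|M0] := eqVneq #|mesh N| 0%N.
  by rewrite !big1// => g; case: (fintype0 g g0).
apply: (mulfI (_ : #|mesh N|%:R != 0)); first by rewrite pnatr_eq0.
apply: (fmorph_inj (real_complex R)).
apply: etrans (esym (vparseval _ _)) (etrans _ (vparseval _ _)).
apply: eq_bigr => p _.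
rewrite !curl_symbol.
have -> : map_mx conjc (cross (ivec (wavevec ops p)) (vdft F p)) =
    - cross (ivec (wavevec ops p)) (map_mx conjc (vdft F p)).
  apply/rowP => j; rewrite !mxE rmorphB/= !conjcM.
  have e (x : R) : conjc (0 +i* x) = - (0 +i* x) by rewrite /conjc; simpc.
  by rewrite !e; ring.
by rewrite dotNl dot_crossl opprK.
Qed.

(** The discrete Helmholtz operator 1 - a lap is injective for a >= 0: its
    symbol 1 + a |k|^2 is positive. *)
Lemma helmholtz_eq0 a f : 0 <= a ->
  (forall g, f g = a * lap ops f g) -> forall g, f g = 0.
Proof.
move=> a0 fE; apply: dft_eq0 => p.
have : dft f p = dft (fun g => a * lap ops f g) p.
  by congr dft; apply/funext.
rewrite dftZ lap_symbol; set k2 := dot _ _ => e.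
have k2_ge0 : 0 <= k2 by apply: sumr_ge0 => j _; rewrite -expr2 sqr_ge0.
have : (1 + a * k2)%:C * dft f p = 0.
  by rewrite rmorphD rmorph1 rmorphM/= mulrDl mul1r {1}e; ring.
move/eqP; rewrite mulf_eq0 => /orP[|/eqP//].
move=> /eqP/(congr1 (@complex.Re R))/= h.
have : 0 < 1 + a * k2 by rewrite ltr_pwDl// mulr_ge0.
by rewrite h ltxx.
Qed.

End SpectralCalculus.

(** * Gauge constraints and energy balance of the fields *)

Section FieldUpdate.
Context {R : realType} (N : 'I_3 -> nat) (ops : spectral_ops R N).
Context (kappa sigma1 sigma2 dt : R).
Context (kappa_gt0 : 0 < kappa) (dt_gt0 : 0 < dt).
Context (sigma12 : sigma1 = kappa ^+ 2 * sigma2).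
Context (phi psi rho : nat -> mesh N -> R) (A U J : nat -> mesh N -> 'rV[R]_3).
Context (phi_step : forall n g, (phi n.+1 g - phi n g) / dt = mid psi n g).
Context (psi_step : forall n g, (psi n.+1 g - psi n g) / dt =
  kappa ^+ 2 * lap ops (mid phi n) g + kappa ^+ 2 * sigma1 * mid rho n g).
Context (A_step : forall n g, dt^-1 *: (A n.+1 g - A n g) = mid U n g).
Context (U_step : forall n g, dt^-1 *: (U n.+1 g - U n g) =
  kappa ^+ 2 *: vlap ops (mid A n) g + (kappa ^+ 2 * sigma2) *: J n g).
Context (rho_step : forall n g,
  (rho n.+1 g - rho n g) / dt + div ops (J n) g = 0).
Context (lorenz_init : forall g,
  (kappa ^+ 2)^-1 * psi 0%N g + div ops (A 0%N) g = 0).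
Context (gauss_init : forall g,
  div ops (electric ops (phi 0%N) (U 0%N)) g = sigma1 * rho 0%N g).

Lemma mid_scalar (f : nat -> mesh N -> R) n g :
  mid f n g = 2^-1 * (f n.+1 g + f n g).
Proof. by []. Qed.

Lemma lap_mid (f : nat -> mesh N -> R) n g :
  lap ops (mid f n) g = 2^-1 * (lap ops (f n.+1) g + lap ops (f n) g).
Proof. by rewrite -lapD -lapZ. Qed.

Lemma div_mid (F : nat -> mesh N -> 'rV[R]_3) n g :
  div ops (mid F n) g = 2^-1 * (div ops (F n.+1) g + div ops (F n) g).
Proof. by rewrite -divD -divZ. Qed.

Lemma curl_mid (F : nat -> mesh N -> 'rV[R]_3) n g :
  curl ops (mid F n) g = 2^-1 *: (curl ops (F n.+1) g + curl ops (F n) g).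
Proof. by rewrite -curlD -curlZ. Qed.

Lemma grad_mid (f : nat -> mesh N -> R) n g :
  grad ops (mid f n) g = 2^-1 *: (grad ops (f n.+1) g + grad ops (f n) g).
Proof. by rewrite -gradD -gradZ. Qed.

Lemma difference_quotient (a b c : R) : (a - b) / dt = c -> a = b + dt * c.
Proof. by move=> <-; field; rewrite gt_eqF. Qed.

Lemma vdifference_quotient (a b c : 'rV[R]_3) :
  dt^-1 *: (a - b) = c -> a = b + dt *: c.
Proof. by move=> <-; rewrite scalerA mulfV ?gt_eqF// scale1r addrC subrK. Qed.

Lemma div_electric f F g :
  div ops (electric ops f F) g = - lap ops f g - div ops F g.
Proof.
have -> : electric ops f F = fun g => (-1) *: grad ops f g + (-1) *: F g.
  by apply/funext => x; rewrite !scaleN1r.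
by rewrite divD !divZ div_grad !mulN1r.
Qed.

(** Both constraints propagate.  If G is the Lorenz residual and F the Gauss
    residual at the new level, and both vanish at the old one, the updates
    give G = - (dt / 2) F and F = - kappa^2 (dt / 2) lap G, and the
    resulting Helmholtz equation for G has only the zero solution. *)
Lemma gauge_preserved n :
  (forall g, (kappa ^+ 2)^-1 * psi n g + div ops (A n) g = 0) /\
  (forall g, div ops (electric ops (phi n) (U n)) g = sigma1 * rho n g).
Proof.
elim: n => [//|n [lorenz gauss]].
have k0 : kappa != 0 by rewrite gt_eqF.
have dt0 : dt != 0 by rewrite gt_eqF.
pose G n g := (kappa ^+ 2)^-1 * psi n g + div ops (A n) g.
pose F n g := - lap ops (phi n) g - div ops (U n) g - sigma1 * rho n g.
have lapG l g : lap ops (G l) g =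
    (kappa ^+ 2)^-1 * lap ops (psi l) g + lap ops (div ops (A l)) g.
  by rewrite -lapZ -lapD.
have Gn : G n = fun=> 0 by apply/funext => g; exact: lorenz.
have lapGn g : lap ops (G n) g = 0.
  by rewrite Gn -[RHS](mul0r (lap ops (fun=> 0) g)) -lapZ; congr lap;
    apply/funext => x; rewrite mul0r.
have Fn g : F n g = 0 by rewrite /F -div_electric gauss subrr.
have lap_phi g : lap ops (phi n.+1) g =
    lap ops (phi n) g + dt * (2^-1 * (lap ops (psi n.+1) g + lap ops (psi n) g)).
  rewrite -lap_mid -lapZ -lapD; congr lap; apply/funext => x.
  exact/difference_quotient/phi_step.
have psiE g := difference_quotient (psi_step n g).
have divA g : div ops (A n.+1) g =
    div ops (A n) g + dt * (2^-1 * (div ops (U n.+1) g + div ops (U n) g)).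
  rewrite -div_mid -divZ -divD; congr div; apply/funext => x.
  exact/vdifference_quotient/A_step.
have divU g : div ops (U n.+1) g = div ops (U n) g +
    dt * (kappa ^+ 2 * (2^-1 * (lap ops (div ops (A n.+1)) g
                                 + lap ops (div ops (A n)) g))
         + kappa ^+ 2 * sigma2 * div ops (J n) g).
  rewrite -(lap_mid (fun n => div ops (A n))) -divZ.
  have <- : div ops (vlap ops (mid A n)) g = lap ops (mid (fun n => div ops (A n)) n) g.
    by rewrite div_vlap; congr lap; apply/funext => x; exact: div_mid.
  rewrite -divZ -divD -divZ -divD; congr div; apply/funext => x.
  exact/vdifference_quotient/U_step.
have rhoE g : rho n.+1 g = rho n g - dt * div ops (J n) g.
  have := rho_step n g; move/eqP; rewrite addr_eq0 => /eqP/difference_quotient ->.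
  by rewrite mulrN.
(* Multiples of the residuals at level n, which vanish, are subtracted from both
   sides; a rational identity in the updates remains. *)
have GF g : G n.+1 g = - (dt / 2) * F n.+1 g.
  rewrite -[LHS]subr0 -(lorenz g) -[RHS]subr0.
  rewrite -[X in _ = _ - X](mulr0 (dt / 2)) -(Fn g) /G /F psiE divA lap_mid mid_scalar.
  by field.
have FG g : F n.+1 g = - (kappa ^+ 2 * dt / 2) * lap ops (G n.+1) g.
  rewrite -[LHS]subr0 -(Fn g) -[RHS]subr0.
  rewrite -[X in _ = _ - X](mulr0 (kappa ^+ 2 * dt / 2)) -(lapGn g) /F.
  rewrite lap_phi divU rhoE !lapG sigma12; by field.
have G0 : forall g, G n.+1 g = 0.
  apply: (@helmholtz_eq0 _ _ ops (kappa ^+ 2 * (dt / 2) ^+ 2)).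
    by rewrite mulr_ge0// sqr_ge0.
  by move=> g; rewrite GF FG; field.
split=> g; first exact: G0.
have : F n.+1 g = 0.
  have /eqP := G0 g; rewrite GF mulf_eq0 oppr_eq0 mulf_eq0 (negbTE dt0) invr_eq0.
  by rewrite pnatr_eq0 => /eqP.
by rewrite /F -div_electric => /subr0_eq.
Qed.

(** Ampere's law, in which the Lorenz gauge supplies the gradient of the
    divergence of A missing from the wave equation. *)
Lemma ampere n g :
  electric ops (phi n.+1) (U n.+1) g = electric ops (phi n) (U n) g +
  dt *: (kappa ^+ 2 *: curl ops (curl ops (mid A n)) g - sigma1 *: J n g).
Proof.
have grad_phi : grad ops (phi n.+1) g = grad ops (phi n) g +
    dt *: grad ops (mid psi n) g.
  rewrite -gradZ -gradD; congr grad; apply/funext => x.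
  exact/difference_quotient/phi_step.
have -> : curl ops (curl ops (mid A n)) g =
    - (kappa ^+ 2)^-1 *: grad ops (mid psi n) g - vlap ops (mid A n) g.
  rewrite curl_curl -gradZ; congr (grad _ _ _ - _); apply/funext => x.
  have [+ _] := gauge_preserved n.+1; have [+ _] := gauge_preserved n.
  move=> /(_ x)/eqP; rewrite addrC addr_eq0 => /eqP e.
  move=> /(_ x)/eqP; rewrite addrC addr_eq0 => /eqP e'.
  by rewrite div_mid e e' mid_scalar; ring.
rewrite /electric grad_phi (vdifference_quotient (U_step n g)) sigma12.
apply/rowP => j; rewrite !mxE; field; by rewrite gt_eqF.
Qed.

Lemma faraday n g :
  magnetic ops (A n.+1) g = magnetic ops (A n) g -
  dt *: curl ops (mid (fun n => electric ops (phi n) (U n)) n) g.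
Proof.
have -> : magnetic ops (A n.+1) g = magnetic ops (A n) g + dt *: curl ops (mid U n) g.
  rewrite /magnetic -curlZ -curlD; congr curl; apply/funext => x.
  exact/vdifference_quotient/A_step.
congr (_ + _); rewrite -scalerN; congr (_ *: _).
have -> : mid (fun n => electric ops (phi n) (U n)) n =
    fun g => (-1) *: grad ops (mid phi n) g + (-1) *: mid U n g.
  by apply/funext => x; rewrite grad_mid /mid /electric; apply/rowP => j; rewrite !mxE; ring.
by rewrite curlD !curlZ curl_grad scaler0 add0r scaleN1r opprK.
Qed.

Lemma dot_diff_squares (u v : 'rV[R]_3) :
  dot u u - dot v v = dot (u + v) (u - v).
Proof. by rewrite dotDl !dotBr (dotC v u); ring. Qed.

(** Discrete Poynting theorem: the curl terms cancel by summation by parts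
    because kappa^2 / sigma1 = 1 / sigma2.  The right-hand side is
    - dt times the sum of J . E, as E = - (grad phi + U). *)
Lemma field_energy_step n (sigma2_gt0 : 0 < sigma2) :
  \sum_g ((2 * sigma1)^-1 * dot (electric ops (phi n.+1) (U n.+1) g)
                                (electric ops (phi n.+1) (U n.+1) g)
    + (2 * sigma2)^-1 * dot (magnetic ops (A n.+1) g) (magnetic ops (A n.+1) g))
  - \sum_g ((2 * sigma1)^-1 * dot (electric ops (phi n) (U n) g)
                                (electric ops (phi n) (U n) g)
    + (2 * sigma2)^-1 * dot (magnetic ops (A n) g) (magnetic ops (A n) g))
  = dt * \sum_g dot (J n g) (grad ops (mid phi n) g + mid U n g).
Proof.
pose E n g := electric ops (phi n) (U n) g.
pose B n g := magnetic ops (A n) g.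
have k0 : kappa != 0 by rewrite gt_eqF.
have s0 : sigma2 != 0 by rewrite gt_eqF.
have midE g : mid E n g = - (grad ops (mid phi n) g + mid U n g).
  by rewrite grad_mid /mid /E /electric; apply/rowP => j; rewrite !mxE; ring.
transitivity (dt / sigma2 * \sum_g (dot (mid E n g) (curl ops (mid B n) g)
    - dot (mid B n g) (curl ops (mid E n) g))
  - dt * \sum_g dot (J n g) (mid E n g)).
  rewrite -sumrB !mulr_sumr -sumrB; apply: eq_bigr => g _.
  have curlB : curl ops (curl ops (mid A n)) g = curl ops (mid B n) g.
    by congr curl; apply/funext => x; rewrite curl_mid.
  rewrite -/(E _ _) -/(E _ _) -/(B _ _) -/(B _ _).
  have e2 (X : nat -> mesh N -> 'rV[R]_3) :
      dot (X n.+1 g) (X n.+1 g) - dot (X n g) (X n g) =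
      2 * dot (mid X n g) (X n.+1 g - X n g).
    rewrite dot_diff_squares /mid dotZl mulrA mulfV ?mul1r// pnatr_eq0.
  have eE : E n.+1 g - E n g =
      dt *: (kappa ^+ 2 *: curl ops (mid B n) g - sigma1 *: J n g).
    by rewrite /E ampere curlB addrC addKr.
  have eB : B n.+1 g - B n g = - (dt *: curl ops (mid E n) g).
    by rewrite /B faraday addrC addKr.
  transitivity ((2 * sigma1)^-1 * (dot (E n.+1 g) (E n.+1 g) - dot (E n g) (E n g))
     + (2 * sigma2)^-1 * (dot (B n.+1 g) (B n.+1 g) - dot (B n g) (B n g))).
    by ring.
  rewrite !e2 eE eB; move: (mid E n g) (mid B n g) => e b.
  by rewrite dotNr !(dotZr, dotBr) (dotC e (J n g)) sigma12; field; rewrite s0 k0.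
rewrite sumrB (eq_bigr (fun g => dot (curl ops (mid B n) g) (mid E n g))); last first.
  by move=> g _; rewrite dotC.
rewrite sum_dot_curl subrr mulr0 sub0r -mulrN -sumrN; congr (_ * _).
by apply: eq_bigr => g _; rewrite midE dotNr opprK.
Qed.

End FieldUpdate.

(** * Piecewise regular functions on the unit interval *)

Section PiecewiseRegularity.
Context {R : realType}.
Implicit Types (f g df G : R -> R) (K : seq R) (a b c : R).
Notation mu := (@lebesgue_measure R).

(** [a, b] is a nondegenerate piece of the unit interval with no break point
    of K in its interior. *)
Definition piece K a b : Prop :=
  [/\ 0 <= a, a < b, b <= 1 & forall k, k \in K -> ~~ (a < k < b)].

(** f agrees inside each piece with a function continuous on the whole line;
    the values at the finitely many break points are unconstrained. *)
Definition piecewise_continuous f : Prop :=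
  exists K, forall a b, piece K a b ->
    exists2 G, continuous G & {in `]a, b[, f =1 G}.

(** On each closed piece f agrees with a continuously differentiable function
    whose derivative is df inside the piece; f is thus continuous. *)
Definition piecewise_C1 f df : Prop :=
  exists K, forall a b, piece K a b -> exists F G,
    [/\ forall x, is_derive x (1 : R) F (G x), continuous G,
        {in `[a, b], f =1 F} & {in `]a, b[, df =1 G}].

Lemma piece_catl K1 K2 a b : piece (K1 ++ K2) a b -> piece K1 a b.
Proof. by case=> ? ? ? h; split=> // k kK; apply: h; rewrite mem_cat kK. Qed.

Lemma piece_catr K1 K2 a b : piece (K1 ++ K2) a b -> piece K2 a b.
Proof. by case=> ? ? ? h; split=> // k kK; apply: h; rewrite mem_cat kK orbT. Qed.

(** A property of intervals that holds on pieces and is stable under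
    concatenation holds on the unit interval. *)
Lemma piece_ind K (P : R -> R -> Prop) :
  (forall a b, piece K a b -> P a b) ->
  (forall a c b, a < c -> c < b -> P a c -> P c b -> P a b) -> P 0 1.
Proof.
move=> P0 PS.
(* Induction on the number of break points inside [a, b]. *)
suff H n a b : (count (fun k => (a < k < b)%R) K < n)%N -> 0 <= a -> a < b -> b <= 1 -> P a b.
  by apply: (H _ 0 1 (ltnSn _)).
elim: n a b => // n IH a b; rewrite ltnS => Kn a0 ab b1.
have [/hasP[k kK akb]|/hasPn noK] := boolP (has (fun k => (a < k < b)%R) K); last first.
  by apply: P0; split.
have /andP[ak kb] := akb.
have lt_count (p r : pred R) : {subset p <= r} -> k \in r -> k \notin p ->
    (count p K < count r K)%N.
  move=> pr rk pk; elim: K kK {Kn P0 IH} => //= x s IHs.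
  rewrite inE => /predU1P[<-|ks].
    rewrite -[k \in r]/(r k) in rk; rewrite -[k \in p]/(p k) in pk.
    by rewrite (negbTE pk) rk add0n add1n ltnS; apply: sub_count => y; apply: pr.
  rewrite -addnS leq_add ?IHs//; case px: (p x) => //.
  by have -> : r x = true := pr x px.
apply: (PS a k b ak kb); apply: IH => //.
- apply: leq_trans Kn; apply: lt_count => [x|//|].
    by rewrite !unfold_in => /andP[-> /lt_trans->].
  by rewrite unfold_in ltxx andbF.
- exact: ltW (lt_le_trans kb b1).
- apply: leq_trans Kn; apply: lt_count => [x|//|].
    by rewrite !unfold_in => /andP[/(lt_trans ak)-> ->].
  by rewrite unfold_in ltxx.
- exact: le_trans a0 (ltW ak).
Qed.

Lemma continuous_piecewise f : continuous f -> piecewise_continuous f.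
Proof. by move=> cf; exists [::] => a b _; exists f. Qed.

Lemma piecewise_continuousM f g : piecewise_continuous f ->
  piecewise_continuous g -> piecewise_continuous (fun x => f x * g x).
Proof.
move=> [K1 f1] [K2 g2]; exists (K1 ++ K2) => a b ab.
have [F cF fF] := f1 _ _ (piece_catl ab).
have [G cG gG] := g2 _ _ (piece_catr ab).
exists (fun x => F x * G x); first by move=> x; apply: cvgM; [exact: cF|exact: cG].
by move=> x xab; rewrite fF ?gG.
Qed.

Lemma piecewise_continuousZ (c : R) (f : R -> R) : piecewise_continuous f ->
  piecewise_continuous (fun s => c * f s).
Proof.
by apply: piecewise_continuousM; apply: continuous_piecewise; exact: cst_continuous.
Qed.

Lemma piecewise_continuousD (f g : R -> R) : piecewise_continuous f ->
  piecewise_continuous g -> piecewise_continuous (fun x => f x + g x).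
Proof.
move=> [K1 f1] [K2 g2]; exists (K1 ++ K2) => a b ab.
have [F cF fF] := f1 _ _ (piece_catl ab).
have [G cG gG] := g2 _ _ (piece_catr ab).
exists (fun x => F x + G x); first by move=> x; apply: cvgD; [exact: cF|exact: cG].
by move=> x xab; rewrite fF ?gG.
Qed.

Lemma piecewise_continuous_prod (T : Type) (s : seq T) (P : pred T) (F : T -> R -> R) :
  (forall t, piecewise_continuous (F t)) ->
  piecewise_continuous (fun x => \prod_(t <- s | P t) F t x).
Proof.
move=> pF; elim: s => [|t s IH].
  under eq_fun do rewrite big_nil; apply: continuous_piecewise; exact: cst_continuous.
under eq_fun do rewrite big_cons.
by case: (P t) => //; apply: piecewise_continuousM.
Qed.

Lemma C1_piecewise F G : (forall x, is_derive x (1 : R) F (G x)) -> continuous G ->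
  piecewise_C1 F G.
Proof. by move=> dF cG; exists [::] => a b _; exists F, G; split. Qed.

Lemma piecewise_C1_continuous f df : piecewise_C1 f df -> piecewise_continuous f.
Proof.
move=> [K h]; exists K => a b /h[F [G [dF _ fF _]]]; exists F.
  by move=> x; apply/differentiable_continuous/derivable1_diffP; case: (dF x).
by move=> x; rewrite in_itv/= => /andP[/ltW ax /ltW xb]; apply: fF; rewrite in_itv/= ax.
Qed.

Lemma piecewise_C1M f df g dg : piecewise_C1 f df -> piecewise_C1 g dg ->
  piecewise_C1 (fun x => f x * g x) (fun x => df x * g x + f x * dg x).
Proof.
move=> [K1 f1] [K2 g2]; exists (K1 ++ K2) => a b ab.
have [F [F' [dF cF' fF fF']]] := f1 _ _ (piece_catl ab).
have [G [G' [dG cG' gG gG']]] := g2 _ _ (piece_catr ab).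
have cts (H H' : R -> R) : (forall x, is_derive x (1 : R) H (H' x)) -> continuous H.
  by move=> dH x; apply/differentiable_continuous/derivable1_diffP; case: (dH x).
have cF := cts _ _ dF; have cG := cts _ _ dG.
exists (fun x => F x * G x), (fun x => F' x * G x + F x * G' x); split.
- move=> x; apply: (is_derive_eq (is_deriveM (dF x) (dG x))).
  by rewrite /GRing.scale/= addrC [G x * _]mulrC.
- move=> x; apply: cvgD; apply: cvgM; by [exact: cF|exact: cG|exact: cF'|exact: cG'].
- by move=> x xab; rewrite fF ?gG.
- move=> x xab; have xab' : x \in `[a, b].
    by move: xab; rewrite !in_itv/= => /andP[/ltW-> /ltW->].
  by rewrite fF ?gG// fF' ?gG'.
Qed.

Lemma piecewise_continuous_integrable f : piecewise_continuous f ->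
  mu.-integrable `[0, 1] (EFin \o f).
Proof.
move=> [K h].
suff [mf [M fM]] : measurable_fun (`[0, 1]%classic : set R) f /\
    exists M, forall x, 0 <= x <= 1 -> `|f x| <= M.
  apply: measurable_bounded_integrable => //.
    exact/compact_finite_measure/segment_compact.
  exists M; split; first exact: num_real.
  by move=> N MN x/=; rewrite in_itv/= => x01; apply: le_trans (fM _ x01) (ltW MN).
apply: (@piece_ind K (fun a b => measurable_fun (`[a, b]%classic : set R) f /\
    exists M, forall x, a <= x <= b -> `|f x| <= M)).
- move=> a b ab; have [G cG fG] := h a b ab; case: ab => _ ab _ _; split.
    apply: (@measurable_fun_itv_cc _ _ _ false true).
    apply: (eq_measurable_fun G); first by move=> x /set_mem xab; rewrite fG.
    by apply: measurable_funTS; apply: continuous_measurable_fun.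
  have cnG : {within `[a, b], continuous (fun x => `|G x|)}%classic.
    by apply: continuous_subspaceT => x; apply: cvg_norm; exact: cG.
  have [c _ cmax] := EVT_max (ltW ab) cnG.
  (* f is unrelated to G at the end points, whose values enter the bound. *)
  exists (Num.max `|G c| (Num.max `|f a| `|f b|)) => x /andP[].
  rewrite le_eqVlt => /predU1P[<- _|ax]; first by rewrite !le_max lexx orbT.
  rewrite le_eqVlt => /predU1P[->|xb]; first by rewrite !le_max lexx !orbT.
  rewrite fG ?in_itv/= ?ax// le_max cmax// in_itv/=; by rewrite !ltW.
- move=> a c b ac cb [m1 [M1 h1]] [m2 [M2 h2]]; split.
    have -> : (`[a, b] = `[a, c] `|` `[c, b] :> set R)%classic.
      apply/seteqP; split=> x /=; rewrite !in_itv/=.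
        move=> /andP[ax xb]; have [xc|/ltW cx] := leP x c; first by left; rewrite ax.
        by right; rewrite cx xb.
      by case=> /andP[ax xb]; rewrite ?ax ?xb ?andbT/=;
        [exact: le_trans xb (ltW cb)|exact: le_trans (ltW ac) ax].
    by apply/measurable_funU.
  exists (Num.max M1 M2) => x /andP[ax xb]; rewrite le_max.
  have [xc|cx] := leP x c; first by rewrite h1 ?ax.
  by rewrite h2 ?orbT// ltW.
Qed.

(** The fundamental theorem of calculus on the unit interval. *)
Lemma piecewise_FTC f df : piecewise_C1 f df ->
  \int[mu]_(x in `[0, 1]) df x = f 1 - f 0.
Proof.
move=> pf.
have idf : mu.-integrable `[0, 1] (EFin \o df).
  case: pf => K h; apply: piecewise_continuous_integrable; exists K => a b /h.
  by case=> F [G [_ cG _ dfG]]; exists G.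
case: pf => K h.
suff: 0 <= 0 :> R -> 1 <= 1 :> R -> \int[mu]_(x in `[0, 1]) df x = f 1 - f 0.
  by apply.
apply: (@piece_ind K (fun a b => 0 <= a -> b <= 1 ->
  \int[mu]_(x in `[a, b]) df x = f b - f a)).
- move=> a b ab _ _; have [F [G [dF cG fF dfG]]] := h a b ab.
  case: ab => _ ab _ _.
  have cF : continuous F.
    by move=> x; apply/differentiable_continuous/derivable1_diffP; case: (dF x).
  have mG : measurable_fun (`]a, b[%classic : set R) G.
    by apply: measurable_funTS; apply: continuous_measurable_fun.
  have := @continuous_FTC2 _ G F a b ab; rewrite /Rintegral.
  rewrite (@eq_integral_itv_bounded _ a b G df true false) => //; last first.
    by apply: (eq_measurable_fun G) => // x /set_mem xab; rewrite dfG.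
  move=> ->.
  + by rewrite !fF// in_itv/= lexx ltW.
  + exact: continuous_subspaceT.
  + split=> [x _||]; first by case: (dF x).
      by apply: cvg_at_right_filter; exact: cF.
    by apply: cvg_at_left_filter; exact: cF.
  + by move=> x _; rewrite derive1E; case: (dF x).
- move=> a c b ac cb IH1 IH2 a0 b1.
  have idf' : mu.-integrable `[a, b] (EFin \o df).
    apply: integrableS idf => //; apply: subset_itv; by rewrite bnd_simp.
  have := @Rintegral_itvB _ df (BLeft a) (BRight b) c idf'.
  rewrite !bnd_simp !ltW// => /(_ isT isT)/eqP; rewrite subr_eq => /eqP ->.
  rewrite Rintegral_itv_obnd_cbnd; last first.
    by apply: integrableS idf' => //; apply: subset_itv; rewrite bnd_simp// ltW.
  rewrite IH1 ?IH2 ?(le_trans a0)// ?(le_trans _ b1)// ?ltW//.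
  by rewrite subrKA.
Qed.

End PiecewiseRegularity.

(** * Particle shapes along a straight orbit *)

Section ShapeAlongLine.
Context {R : realType}.
Local Open Scope classical_set_scope.
Notation mu := (@lebesgue_measure R).

(** A one-sided derivative taken where w coincides with a polynomial p is the
    derivative of p, whichever side was chosen. *)
Lemma one_sided_derivative_poly (w dw : R -> R) (p : {poly R}) (y : R) :
  one_sided_derivative w dw -> (\forall z \near y, w z = p.[z]) ->
  dw y = p^`().[y].
Proof.
move=> wdw wp.
have lim_p : h^-1 * (w (y + h) - w y) @[h --> 0^'] --> p^`().[y].
  have [dp <-] := is_derive_poly p y.
  apply: cvg_trans dp; apply: near_eq_cvg.
  have near0 : \forall h \near 0^', w (y + h) = p.[y + h].
    have : (fun h => y + h) @ 0^' --> y + 0.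
      by apply: cvg_within_filter; apply: cvgD; [exact: cvg_cst|exact: cvg_id].
    by rewrite addr0 => /(_ _ wp).
  near=> h; rewrite /= (near near0 h)// (nbhs_singleton wp).
  by rewrite /GRing.scale/= mulr1 [h + y]addrC.
have [wy|wy] := wdw y.
  exact: (cvg_unique _ wy (cvg_dnbhs_at_left lim_p)).
exact: (cvg_unique _ wy (cvg_dnbhs_at_right lim_p)).
Unshelve. all: by end_near. Qed.

Lemma periodic_int (l : R) (w : R -> R) : (forall x, w (x + l) = w x) ->
  forall (n : int) x, w (x + n%:~R * l) = w x.
Proof.
move=> wl n; have nat_per (k : nat) x : w (x + k%:R * l) = w x.
  elim: k => [|k IH]; first by rewrite mul0r addr0.
  by rewrite -natr1 mulrDl mul1r addrA wl.
case: n => k x; first exact: nat_per.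
by rewrite NegzE -[in RHS](subrK (k.+1%:R * l) x) mulrNz mulNr nat_per.
Qed.

Lemma knot_bracket (t : nat -> R) (m : nat) (y : R) : t 0%N <= y < t m ->
  exists2 i, (i < m)%N & t i <= y < t i.+1.
Proof.
elim: m => [|m IH] /andP[t0 tm].
  by have := le_lt_trans t0 tm; rewrite ltxx.
have [ym|my] := ltP y (t m); last by exists m => //; rewrite my.
by have [|i im h] := IH; [rewrite t0|exists i => //; exact: leqW].
Qed.

(** A linear function of s whose zero k is outside ]u, v[ keeps the sign that
    it has at an interior point c. *)
Lemma linear_same_sign (b k u v c s : R) : ~~ (u < k < v) -> u < c < v ->
  u <= s <= v -> 0 <= (c - k) * b -> 0 <= (s - k) * b.
Proof.
rewrite negb_and -!leNgt => + /andP[uc cv] /andP[us sv].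
case/orP=> [ku|vk].
  have ck : 0 < c - k by rewrite subr_gt0; exact: le_lt_trans ku uc.
  rewrite pmulr_rge0// => b0; apply: mulr_ge0 => //.
  by rewrite subr_ge0; exact: le_trans ku us.
have ck : c - k < 0 by rewrite subr_lt0; exact: lt_le_trans cv vk.
rewrite nmulr_rge0// => b0; apply: mulr_le0 => //.
by rewrite subr_le0; exact: le_trans sv vk.
Qed.

Lemma int_window (n : int) (M : nat) : (`|n| < M%:Z)%R ->
  exists2 j, (j < M + M)%N & n = (j%:Z - M%:Z)%R.
Proof.
case: n => k kM; first by exists (k + M)%N; lia.
by exists (M - k.+1)%N; lia.
Qed.

(** Along a line that is not constant, a periodic piecewise polynomial is a
    single polynomial between consecutive break points; the break points are
    the finitely many knots met for parameters in the unit interval. *)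
Lemma line_pieces (l : R) (w : R -> R) (a b : R) : 0 < l -> b != 0 ->
  periodic_piecewise_poly l w -> exists K : seq R, forall u v, piece K u v ->
  exists p : {poly R}, forall s, u <= s <= v -> w (a + s * b) = p.[a + s * b].
Proof.
move=> l0 b0 [_ wl [m [t [tm _ tp]]]].
(* B + 1 bounds |n| for every period [t 0 + n l, t 0 + (n + 1) l[ that contains
   the image of a point of the unit interval. *)
pose B := (`|a - t 0%N| + `|b|) / l.
pose M := (Num.truncn B).+2.
pose knot (i : nat) (n : int) := (t i + n%:~R * l - a) / b.
exists [seq knot i n | i <- iota 0 m.+1,
                       n <- [seq Posz j - Posz M | j <- iota 0 (M + M)]].
move=> u v [u0 uv v1 noK].
(* The image of the midpoint lies between two knots; as no knot comes from the
   interior of [u, v], the whole image of [u, v] lies between them. *)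
pose c := (u + v) / 2; pose y := a + c * b.
have ucv : u < c < v by rewrite /c; apply/andP; split; lra.
pose n := Num.floor ((y - t 0%N) / l).
have /andP[ny yn] := floor_itv ((y - t 0%N) / l).
rewrite -/n ler_pdivlMr// in ny; rewrite -/n ltr_pdivrMr// intrD mulrDl mul1r in yn.
have nM : `|n%:~R : R| <= B + 1.
  have yB : `|y - t 0%N| <= `|a - t 0%N| + `|b|.
    rewrite /y addrAC (le_trans (ler_normD _ _))// lerD2l normrM.
    rewrite ler_piMl// ger0_norm; move: ucv => /andP[]; lra.
  rewrite -[B](mulfK (_ : l != 0)) ?gt_eqF//.
  have -> : B * l / l + 1 = (B * l + l) / l by field; rewrite gt_eqF.
  rewrite ler_pdivlMr// /B divfK ?gt_eqF//.
  have -> : `|n%:~R : R| * l = `|n%:~R * l| by rewrite normrM (gtr0_norm l0).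
  by move: yB; rewrite !ler_norml => /andP[]; lra.
have inK i : (i <= m)%N -> ~~ (u < knot i n < v).
  move=> im; apply: noK; apply/allpairsP; exists (i, n); split => //.
    by rewrite mem_iota.
  have BM : B + 1 < M%:R by rewrite /M -natr1 ltrD2r; exact: truncnS_gt.
  have nM' : (`|n| < M%:Z)%R.
    by rewrite -(ltr_int R) intr_norm; exact: le_lt_trans nM BM.
  have [j jM nj] := int_window nM'.
  by apply/mapP; exists j => //; rewrite mem_iota.
have yper : t 0%N <= y - n%:~R * l < t m by rewrite tm; apply/andP; split; lra.
have [i im /andP[iy yi]] := knot_bracket yper.
have [q qE] := tp i im.
exists (q \Po ('X - (n%:~R * l)%:P)) => s usv.
rewrite horner_comp !hornerE -(periodic_int wl (- n)) mulrNz mulNr.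
apply: qE.
have side i' : (i' <= m)%N -> (c - knot i' n) * b = y - (t i' + n%:~R * l) /\
   (s - knot i' n) * b = a + s * b - (t i' + n%:~R * l).
  by move=> _; rewrite /knot /y; split; field.
have [e1 e2] := side i (ltnW im); have [e3 e4] := side i.+1 im.
apply/andP; split.
  have := linear_same_sign (b := b) (inK i (ltnW im)) ucv usv.
  by rewrite e1 e2; lra.
have := linear_same_sign (b := - b) (inK i.+1 im) ucv usv.
by rewrite !mulrN e3 e4; lra.
Qed.

(** The values of dw at the knots do not matter: either the line meets finitely
    many knots, or it is constant and the derivative is multiplied by b = 0. *)
Lemma piecewise_poly_line (l : R) (w dw : R -> R) (a b : R) : 0 < l ->
  periodic_piecewise_poly l w -> one_sided_derivative w dw ->
  piecewise_C1 (fun s => w (a + s * b)) (fun s => b * dw (a + s * b)) /\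
  piecewise_continuous (fun s => dw (a + s * b)).
Proof.
move=> l0 pw wdw; have [->|b0] := eqVneq b 0.
  split.
    apply: C1_piecewise.
      by move=> s; rewrite mul0r; under eq_fun do rewrite mulr0; exact: is_derive_cst.
    by under eq_fun do rewrite mul0r; exact: cst_continuous.
  by apply: continuous_piecewise; under eq_fun do rewrite mulr0; exact: cst_continuous.
have [K pK] := line_pieces a l0 b0 pw.
have cts : continuous ((fun s => a + s * b) : R -> R).
  by move=> s; apply: cvgD; [exact: cvg_cst|apply: cvgMl; exact: cvg_id].
have dwE u v (p : {poly R}) : (forall s, u <= s <= v -> w (a + s * b) = p.[a + s * b]) ->
    {in `]u, v[%R, (fun s => dw (a + s * b)) =1 (fun s => p^`().[a + s * b])}.
  move=> wp s suv; apply: (one_sided_derivative_poly wdw).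
  have : (fun z : R => (z - a) / b) @ (a + s * b) --> (a + s * b - a) / b.
    by apply: cvgMl; apply: cvgB; [exact: cvg_id|exact: cvg_cst].
  rewrite [a + _]addrC addrK mulfK// [_ + a]addrC => /(_ _ (near_in_itvoo suv)).
  move=> near_s; near=> z.
  have zuv : u < (z - a) / b < v.
    by have : (z - a) / b \in `]u, v[%R; [near: z; exact: near_s|rewrite in_itv].
  have zE : a + (z - a) / b * b = z by rewrite divfK// addrC subrK.
  by rewrite -zE wp//; case/andP: zuv => /ltW-> /ltW->.
split; exists K => u v /pK[p wp].
- pose r := p \Po (b *: 'X + a%:P).
  have rE s : r.[s] = p.[a + s * b].
    by rewrite horner_comp !hornerE [_ + a]addrC [b * s]mulrC.
  have r'E s : r^`().[s] = b * p^`().[a + s * b].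
    rewrite deriv_comp hornerM horner_comp derivD derivZ derivX derivC !hornerE.
    by rewrite mulrC [_ + a]addrC [b * s]mulrC.
  exists (horner r), (horner r^`()); split.
  + by move=> s; exact: is_derive_poly.
  + exact: continuous_horner.
  + by move=> s; rewrite in_itv/= => suv; rewrite rE wp.
  + by move=> s suv; rewrite r'E (dwE _ _ _ wp).
- exists (fun s => p^`().[a + s * b]); last exact: dwE.
  by move=> s; apply: (continuous_comp (cts s)); exact: continuous_horner.
Unshelve. all: by end_near. Qed.

End ShapeAlongLine.

Section OrbitWork.
Context {R : realType}.
Local Open Scope classical_set_scope.
Notation mu := (@lebesgue_measure R).

Lemma sum_ord3 (V : nmodType) (F : 'I_3 -> V) :
  \sum_(j < 3) F j = F 0 + F 1 + F 2.
Proof.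
rewrite !big_ord_recl big_ord0 addr0 addrA.
by congr (F _ + F _ + F _); apply/val_inj.
Qed.

Lemma prod_ord3 (P : pred 'I_3) (F : 'I_3 -> R) : \prod_(j < 3 | P j) F j =
  (if P 0 then F 0 else 1) * (if P 1 then F 1 else 1) * (if P 2 then F 2 else 1).
Proof.
rewrite big_mkcond !big_ord_recl big_ord0/= mulr1 mulrA.
have -> : lift ord0 ord0 = 1 :> 'I_3 by apply/val_inj.
by have -> : lift ord0 (lift ord0 ord0) = 2 :> 'I_3 by apply/val_inj.
Qed.

Lemma is_derive_line (V : normedModType R) (S : V -> R) (x d : V) (s l : R) :
  is_derive (x + s *: d) d S l ->
  is_derive s (1 : R) (fun s => S (x + s *: d)) l.
Proof.
move=> [dS <-].
have e : (fun h : R => h^-1 *: (((fun s => S (x + s *: d)) \o shift s) (h *: 1) -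
      S (x + s *: d))) =
    (fun h : R => h^-1 *: ((S \o shift (x + s *: d)) (h *: d) - S (x + s *: d))).
  apply/funext => h /=; rewrite [h%:A]mulr1 scalerDl.
  by rewrite addrCA.
by split; rewrite /derivable /derive e.
Qed.

Lemma derive_axes (S : 'rV[R]_3 -> R) (x d : 'rV[R]_3) : differentiable S x ->
  is_derive x d S (\sum_(j < 3) d 0 j * 'D_(axis R j) S x).
Proof.
move=> dS; split; first exact: diff_derivable.
rewrite deriveE// {1}(row_sum_delta d) linear_sum; apply: eq_bigr => j _.
by rewrite linearZ deriveE.
Qed.

Lemma cts_line (x d : 'rV[R]_3) : continuous (fun s : R => x + s *: d).
Proof.
by move=> s; apply: cvgD; [exact: cvg_cst|apply: cvgZl; exact: cvg_id].
Qed.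

(** For both kinds of shape, the partial derivatives dS compute the derivative
    along any line, up to finitely many parameters in the unit interval. *)
Lemma shape_line (L : 'rV[R]_3) (S : 'rV[R]_3 -> R) dS (x d : 'rV[R]_3) :
  (forall j, 0 < L 0 j) -> particle_shape L S dS ->
  piecewise_C1 (fun s => S (x + s *: d))
               (fun s => \sum_(j < 3) d 0 j * dS j (x + s *: d)) /\
  forall j, piecewise_continuous (fun s => dS j (x + s *: d)).
Proof.
move=> L0 [_ [[diffS cdS dSE]|[w [dw [pw wdw SE dSE]]]]].
  have cD j : continuous (fun s : R => dS j (x + s *: d)).
    under eq_fun do rewrite dSE.
    move=> s; apply: (@continuous_comp _ _ _ (fun s : R => x + s *: d)
      (fun y => 'D_(axis R j) S y)); [exact: cts_line|exact: cdS].
  split=> [|j]; last exact: continuous_piecewise.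
  apply: C1_piecewise.
    move=> s; apply: is_derive_line; under eq_bigr do rewrite dSE.
    exact: derive_axes.
  under eq_fun do rewrite !big_ord_recl big_ord0.
  move=> s; do ![apply: cvgD; last exact: cvg_cst|apply: cvgD|
    apply: cvgM; [exact: cvg_cst|exact: cD]].
have line j s : (x + s *: d) 0 j = x 0 j + s * d 0 j by rewrite !mxE.
pose W j (s : R) := w j (x 0 j + s * d 0 j).
pose dW j (s : R) := dw j (x 0 j + s * d 0 j).
have h j := piecewise_poly_line (x 0 j) (d 0 j) (L0 j) (pw j) (wdw j).
split=> [|j]; last first.
  under eq_fun do (rewrite dSE line; under eq_bigr do rewrite line).
  apply: piecewise_continuousM; first exact: (h j).2.
  by apply: piecewise_continuous_prod => k; apply: piecewise_C1_continuous (h k).1.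
have := piecewise_C1M (piecewise_C1M (h 0).1 (h 1).1) (h 2).1.
congr piecewise_C1; apply/funext => s; first by rewrite SE prod_ord3 !line.
by rewrite sum_ord3 !dSE !prod_ord3 !line/=; ring.
Qed.

Lemma Rintegral_pwZ (c : R) (f : R -> R) : piecewise_continuous f ->
  \int[mu]_(s in `[0, 1]) (c * f s) = c * \int[mu]_(s in `[0, 1]) f s.
Proof. by move=> pf; rewrite RintegralZl//; exact: piecewise_continuous_integrable. Qed.

Lemma Rintegral_pwD (f g : R -> R) : piecewise_continuous f ->
  piecewise_continuous g -> \int[mu]_(s in `[0, 1]) (f s + g s) =
  \int[mu]_(s in `[0, 1]) f s + \int[mu]_(s in `[0, 1]) g s.
Proof.
by move=> pf pg; rewrite RintegralD//; exact: piecewise_continuous_integrable.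
Qed.

(** Integrating the derivative of a(s) S(x(s)) along the orbit splits the
    change of a S into a part due to the change of a and a part due to the
    displacement x1 - x0. *)
Lemma orbit_chain_rule (L : 'rV[R]_3) (S : 'rV[R]_3 -> R) dS
    (x0 x1 : 'rV[R]_3) (a0 a1 : R) :
  (forall j, 0 < L 0 j) -> particle_shape L S dS ->
  a1 * S x1 - a0 * S x0 =
  (a1 - a0) * (\int[mu]_(s in `[0, 1]) S (orbit_position x0 x1 s)) +
  \sum_(j < 3) (x1 - x0) 0 j * \int[mu]_(s in `[0, 1])
    (((1 - s) * a0 + s * a1) * dS j (orbit_position x0 x1 s)).
Proof.
move=> L0 shS; have [pS pdS] := shape_line x0 (x1 - x0) L0 shS.
pose a (s : R) := (1 - s) * a0 + s * a1.
have aE : a = horner ((a1 - a0) *: 'X + a0%:P).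
  by apply/funext => s; rewrite /a !hornerE; ring.
have ca : continuous a by rewrite aE; exact: continuous_horner.
have da s : is_derive s (1 : R) a (a1 - a0).
  rewrite aE; apply: (is_derive_eq (is_derive_poly _ _)).
  by rewrite derivD derivZ derivX derivC !hornerE.
have pa : piecewise_C1 a (fun=> a1 - a0).
  by apply: C1_piecewise => //; exact: cst_continuous.
have := piecewise_FTC (piecewise_C1M pa pS).
rewrite scale1r scale0r addr0 addrCA subrr addr0.
have a1E : a 1 = a1 by rewrite /a; ring.
have a0E : a 0 = a0 by rewrite /a; ring.
rewrite a1E a0E => <-.
have pT j : piecewise_continuous (fun s => a s * dS j (x0 + s *: (x1 - x0))).
  by apply: piecewise_continuousM (pdS j); exact: continuous_piecewise.
have -> : (fun s => (a1 - a0) * S (x0 + s *: (x1 - x0)) +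
    a s * (\sum_(j < 3) (x1 - x0) 0 j * dS j (x0 + s *: (x1 - x0)))) =
  (fun s => (a1 - a0) * S (x0 + s *: (x1 - x0)) +
    ((x1 - x0) 0 0 * (a s * dS 0 (x0 + s *: (x1 - x0))) +
     (x1 - x0) 0 1 * (a s * dS 1 (x0 + s *: (x1 - x0))) +
     (x1 - x0) 0 2 * (a s * dS 2 (x0 + s *: (x1 - x0))))).
  by apply/funext => s; rewrite sum_ord3; ring.
have pZ j := piecewise_continuousZ ((x1 - x0) 0 j) (pT j).
have pSc := piecewise_C1_continuous pS.
rewrite Rintegral_pwD; [|exact: piecewise_continuousZ|]; last first.
  by do 2 apply: piecewise_continuousD => //.
rewrite Rintegral_pwD//; last exact: piecewise_continuousD.
rewrite Rintegral_pwD// !Rintegral_pwZ//.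
by rewrite sum_ord3.
Qed.

(** The previous lemma summed over the mesh, for the displacement dt u: the
    discrete gradient matrix appears contracted with u on both sides. *)
Lemma orbit_interp_diff (T : finType) (L : 'rV[R]_3) (S : T -> 'rV[R]_3 -> R) dS
    (A0 A1 : T -> 'rV[R]_3) (x0 x1 u : 'rV[R]_3) (dt : R) :
  (forall j, 0 < L 0 j) -> (forall g, particle_shape L (S g) (dS g)) ->
  x1 = x0 + dt *: u ->
  dot u (interp S A1 x1 - interp S A0 x0) =
  \sum_g orbit_shape S x0 x1 g * dot u (A1 g - A0 g) +
  dt * dot u (u *m orbit_discrete_gradient dS A0 A1 x0 x1).
Proof.
move=> L0 shS x1E.
have dE : x1 - x0 = dt *: u by rewrite x1E addrC addKr.
pose I l j g := \int[mu]_(s in `[0, 1])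
  (((1 - s) * A0 g 0 l + s * A1 g 0 l) * dS g j (orbit_position x0 x1 s)).
have -> : dt * dot u (u *m orbit_discrete_gradient dS A0 A1 x0 x1) =
    \sum_g \sum_(l < 3) u 0 l * \sum_(j < 3) (x1 - x0) 0 j * I l j g.
  rewrite /dot mulr_sumr.
  transitivity (\sum_(j < 3) \sum_(l < 3) \sum_g dt * (u 0 j * (u 0 l * I l j g))).
    apply: eq_bigr => j _; rewrite mxE !mulr_sumr; apply: eq_bigr => l _.
    by rewrite mxE !mulr_sumr; apply: eq_bigr => g _.
  rewrite exchange_big; under eq_bigr do rewrite exchange_big.
  rewrite exchange_big; apply: eq_bigr => g _; apply: eq_bigr => l _.
  by rewrite mulr_sumr; apply: eq_bigr => j _; rewrite dE mxE; ring.
have -> : interp S A1 x1 - interp S A0 x0 =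
    \sum_g (S g x1 *: A1 g - S g x0 *: A0 g) by rewrite sumrB.
rewrite dot_sumr -big_split/=; apply: eq_bigr => g _.
rewrite /dot mulr_sumr -big_split/=; apply: eq_bigr => l _.
have := orbit_chain_rule x0 x1 (A0 g 0 l) (A1 g 0 l) L0 (shS g).
rewrite -/(orbit_shape S x0 x1 g) => e.
rewrite !mxE [S g x1 * _]mulrC [S g x0 * _]mulrC e mulrDr; ring.
Qed.

End OrbitWork.

(** * Energy balance *)

Section ParticlePush.
Context {R : realType}.

(** The kinetic energy gained by a particle of mass m and charge q over one
    step: the two contributions of the discrete gradient matrix cancel, and
    what remains is the work of the field - (G + W) along the orbit.  In the
    scheme G is the gradient of the potential phi and W is U, both taken at
    the half level. *)
Lemma kinetic_energy_step (T : finType) (L : 'rV[R]_3) (S : T -> 'rV[R]_3 -> R) dS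
    (A0 A1 G W : T -> 'rV[R]_3) (x0 x1 v0 v1 P0 P1 u : 'rV[R]_3) (m q dt : R) :
  (forall j, 0 < L 0 j) -> (forall g, particle_shape L (S g) (dS g)) ->
  u = 2^-1 *: (v1 + v0) -> x1 = x0 + dt *: u ->
  P1 = P0 + dt *: (- (q *: orbit_average S G x0 x1)
                   + q *: (u *m orbit_discrete_gradient dS A0 A1 x0 x1)) ->
  m *: v1 = P1 - q *: interp S A1 x1 ->
  m *: v0 = P0 - q *: interp S A0 x0 ->
  (forall g, A1 g - A0 g = dt *: W g) ->
  2^-1 * m * dot v1 v1 - 2^-1 * m * dot v0 v0 =
  - dt * \sum_g q * orbit_shape S x0 x1 g * dot u (G g + W g).
Proof.
move=> L0 shS uE xE PE v1E v0E AE.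
transitivity (dot u (m *: v1 - m *: v0)).
  by rewrite uE dotZl !(dotDl, dotBr, dotZr) (dotC v0 v1); ring.
have -> : m *: v1 - m *: v0 = (P1 - P0) - q *: (interp S A1 x1 - interp S A0 x0).
  by rewrite v1E v0E; apply/rowP => j; rewrite !mxE; ring.
rewrite PE [P0 + _]addrC addrK dotBr !dotZr dotDr dotNr !dotZr.
rewrite (orbit_interp_diff _ _ L0 shS xE).
rewrite /orbit_average dot_sumr.
under [X in q * (X + _)]eq_bigr do rewrite AE dotZr mulrCA.
under [X in - (q * X)]eq_bigr do rewrite dotZr.
under [in RHS]eq_bigr do rewrite dotDr -mulrA mulrDr.
by rewrite -!mulr_sumr big_split/=; ring.
Qed.

End ParticlePush.

Theorem theorem4p2 (R : realType)
  (N : 'I_3 -> nat) (L : 'rV[R]_3)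
  (N_gt0 : forall d, (0 < N d)%N) (L_gt0 : forall d, 0 < L 0 d)
  (ops : spectral_ops R N)
  (S : mesh N -> 'rV[R]_3 -> R) (dS : mesh N -> 'I_3 -> 'rV[R]_3 -> R)
  (S_shape : forall g, particle_shape L (S g) (dS g))
  (kappa sigma1 sigma2 dt : R)
  (kappa_gt0 : 0 < kappa) (sigma1_gt0 : 0 < sigma1) (sigma2_gt0 : 0 < sigma2)
  (dt_gt0 : 0 < dt) (sigma12 : sigma1 = kappa ^+ 2 * sigma2)
  (I : finType) (m q : I -> R) (m_gt0 : forall i, 0 < m i)
  (x v P : nat -> I -> 'rV[R]_3)
  (phi psi rho : nat -> mesh N -> R)
  (A U : nat -> mesh N -> 'rV[R]_3)
  (* J n and vbar n are the values at level n + 1/2 *)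
  (J : nat -> mesh N -> 'rV[R]_3) (vbar : nat -> I -> 'rV[R]_3)
  (* Crank-Nicolson field update *)
  (phi_step : forall n g, (phi n.+1 g - phi n g) / dt = mid psi n g)
  (psi_step : forall n g, (psi n.+1 g - psi n g) / dt =
     kappa ^+ 2 * lap ops (mid phi n) g + kappa ^+ 2 * sigma1 * mid rho n g)
  (A_step : forall n g, dt^-1 *: (A n.+1 g - A n g) = mid U n g)
  (U_step : forall n g, dt^-1 *: (U n.+1 g - U n g) =
     kappa ^+ 2 *: vlap ops (mid A n) g + (kappa ^+ 2 * sigma2) *: J n g)
  (* continuity update *)
  (rho_step : forall n g, (rho n.+1 g - rho n g) / dt + div ops (J n) g = 0)
  (* orbit current *)
  (J_def : forall n g, J n g = (cell_volume N L)^-1 *: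
     \sum_(i : I) (q i * orbit_shape S (x n i) (x n.+1 i) g) *: vbar n i)
  (* particle push; M^T u reads u *m M on row vectors *)
  (vbar_def : forall n i, vbar n i = 2^-1 *: (v n.+1 i + v n i))
  (x_step : forall n i, x n.+1 i = x n i + dt *: vbar n i)
  (P_step : forall n i, P n.+1 i = P n i + dt *:
     (- (q i *: orbit_average S (grad ops (mid phi n)) (x n i) (x n.+1 i))
      + q i *: (vbar n i *m
          orbit_discrete_gradient dS (A n) (A n.+1) (x n i) (x n.+1 i))))
  (v_step : forall n i,
     m i *: v n.+1 i = P n.+1 i - q i *: interp S (A n.+1) (x n.+1 i))
  (v_init : forall i, m i *: v 0%N i = P 0%N i - q i *: interp S (A 0%N) (x 0%N i))
  (* initial Lorenz gauge and Gauss law *)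
  (lorenz_init : forall g,
     (kappa ^+ 2)^-1 * psi 0%N g + div ops (A 0%N) g = 0)
  (gauss_init : forall g,
     div ops (electric ops (phi 0%N) (U 0%N)) g = sigma1 * rho 0%N g) :
  forall n : nat,
    energy L ops m sigma1 sigma2 (v n.+1) (phi n.+1) (A n.+1) (U n.+1)
    = energy L ops m sigma1 sigma2 (v n) (phi n) (A n) (U n).
Proof.
have dtE a b c : dt^-1 *: (a - b) = c -> a - b = dt *: c :> 'rV[R]_3.
  by move=> <-; rewrite scalerA mulfV ?gt_eqF// scale1r.
have vE n i : m i *: v n i = P n i - q i *: interp S (A n) (x n i).
  by case: n => [|n]; [exact: v_init|exact: v_step].
have dV0 : cell_volume N L != 0.
  by rewrite gt_eqF// prodr_gt0// => d _; rewrite divr_gt0// ltr0n.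
move=> n; apply/eqP; rewrite -subr_eq0 /energy -!mulr_suml opprD addrACA -sumrB; apply/eqP.
pose F g := grad ops (mid phi n) g + mid U n g.
have -> : \sum_(i : I) (2^-1 * m i * dot (v n.+1 i) (v n.+1 i)
             - 2^-1 * m i * dot (v n i) (v n i))
    = - dt * (cell_volume N L * \sum_g dot (J n g) (F g)).
  transitivity (\sum_i - dt * \sum_g
      q i * orbit_shape S (x n i) (x n.+1 i) g * dot (vbar n i) (F g)).
    apply: eq_bigr => i _.
    apply: (kinetic_energy_step L_gt0 S_shape (vbar_def n i) (x_step n i)
      (P_step n i) (vE n.+1 i) (vE n i)) => g.
    exact/dtE/A_step.
  rewrite -mulr_sumr exchange_big [cell_volume N L * _]mulr_sumr; congr (_ * _); apply: eq_bigr => g _.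
  rewrite J_def dotZl mulrA mulfV// mul1r dotC dot_sumr.
  by apply: eq_bigr => i _; rewrite dotZr dotC.
rewrite -mulrBl (field_energy_step kappa_gt0 dt_gt0 sigma12 phi_step psi_step
  A_step U_step rho_step lorenz_init gauss_init n sigma2_gt0).
by rewrite -/(F _); ring.
Qed.
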